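(* Let $n\ge 1$, let $\mathcal I\subseteq\mathbb R$ be a time interval, and let $K=K(q^0,q^1,\dots,q^n,\gamma_1,\dots,\gamma_n,t)$ be a smooth function on $\mathbb R^{2n+1}\times\mathcal I$ (a non-autonomous contact Hamiltonian). On the set of points of $\mathbb R^{2n+2}\times\mathcal I$, with coordinates $(q^0,\dots,q^n,p_0,\dots,p_n,t)$, where $p_0\neq 0$, define the non-autonomous Hamiltonian $$H(q^0,q^1,\dots,q^n,p_0,\dots,p_n,t)=-p_0\,K(q^0,q^1,\dots,q^n,\gamma_1,\dots,\gamma_n,t),\qquad \gamma_a=-\frac{p_a}{p_0}\quad(a=1,\dots,n).$$ Then the non-autonomous Hamiltonian system associated with $H$ induces the non-autonomous contact Hamiltonian system associated with $K$: whenever $(q^0,\dots,q^n,p_0,\dots,p_n)(t)$ with $p_0\ne 0$ solves the canonical equations of motion of $H$, the curve $(q^0,\dots,q^n,\gamma_1,\dots,\gamma_n)(t)$ with $\gamma_a=-p_a/p_0$ solves the contact Hamiltonian equations of motion of $K$. Moreover, $\alpha^{\mathrm E}=p_0\,\lambda^{\mathrm E}$, where $\lambda^{\mathrm E}$ is regarded as a $1$-form on $\{p_0\ne0\}\subset\mathbb R^{2n+2}\times\mathcal I$ via $\gamma_a=-p_a/p_0$.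
   Context: All objects are smooth; a dot denotes $d/dt$. Canonical equations of motion of a non-autonomous Hamiltonian $H$ on (an open subset of) $\mathbb R^{2n+2}\times\mathcal I$: $\dot q^a=\partial H/\partial p_a$, $\dot p_a=-\partial H/\partial q^a$ for $a=0,\dots,n$ (and $\dot t=1$). Contact Hamiltonian equations of motion of a non-autonomous contact Hamiltonian $K$ on $\mathbb R^{2n+1}\times\mathcal I$: for $a=1,\dots,n$, $$\dot q^a=\frac{\partial K}{\partial\gamma_a},\qquad \dot\gamma_a=-\frac{\partial K}{\partial q^a}-\gamma_a\frac{\partial K}{\partial q^0},\qquad \dot q^0=-K+\sum_{b=1}^n\gamma_b\frac{\partial K}{\partial\gamma_b},\qquad \dot t=1.$$ Forms: $\alpha=\sum_{a=0}^n p_a\,dq^a$, $\alpha^{\mathrm E}=\alpha-H\,dt$, $\lambda=dq^0-\sum_{a=1}^n\gamma_a\,dq^a$, $\lambda^{\mathrm E}=\lambda+K\,dt$. *)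

(* Defs.v *)
From HB Require Import structures.
From mathcomp Require Import all_boot all_order all_algebra.
From mathcomp Require Import all_classical all_reals all_analysis.

Set Implicit Arguments.
Unset Strict Implicit.
Unset Printing Implicit Defensive.

Import Order.TTheory GRing.Theory Num.Theory.
Import numFieldNormedType.Exports.
Local Open Scope classical_set_scope.
Local Open Scope ring_scope.

(* C^0 is continuity; f is C^(m+1) when it is Frechet differentiable and its
   differential is C^m.  The domain being finite dimensional in every use
   below, the latter is expressed along each fixed direction v. *)
Fixpoint Cn (R : realType) (E : normedModType R) (n : nat) (U : set E)
    (f : E -> R) : Prop :=
  match n with
  | 0%N => forall x, U x -> {for x, continuous f}
  | m.+1 => (forall x, U x -> differentiable f x) /\
            (forall v : E, Cn m U (fun x => 'D_v f x))
  end.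

(* Smoothness on a possibly non-open set A (a time interval may contain its
   endpoints): f locally agrees on A with a function that is C^oo on an open
   set.  The values of f outside A are irrelevant. *)
Definition smooth_on (R : realType) (E : normedModType R) (A : set E)
    (f : E -> R) : Prop :=
  forall x, A x -> exists (U : set E) (g : E -> R),
    [/\ open U, U x, (forall n, Cn n U g) & forall y, A y -> U y -> f y = g y].

Definition time_interval (R : realType) (I : set R) : Prop :=
  is_interval I /\ exists a b, [/\ I a, I b & a < b].

(* Derivative relative to J: one-sided at an endpoint of J that belongs to J,
   the usual derivative at an interior point. *)
Definition is_dot (R : realType) (J : set R) (f : R -> R) (t df : R) : Prop :=
  (s - t)^-1 * (f s - f t) @[s --> within J (t^')] --> df.

(* (q, p, t) with q = (q^0, ..., q^n) and p = (p_0, ..., p_n). *)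
Definition phase (R : realType) (n : nat) : normedModType R :=
  ('rV[R]_n.+1 * 'rV[R]_n.+1 * R)%type.

(* (q, gamma, t) with q = (q^0, ..., q^n) and gamma = (gamma_1, ..., gamma_n).
   The index a : 'I_n of gamma stands for a + 1, so that gamma 0 a is paired
   with q 0 (lift ord0 a). *)
Definition contact (R : realType) (n : nat) : normedModType R :=
  ('rV[R]_n.+1 * 'rV[R]_n * R)%type.

Definition unit_q (R : realType) (n : nat) (a : 'I_n.+1) : phase R n :=
  (delta_mx 0 a, 0, 0).
Definition unit_p (R : realType) (n : nat) (a : 'I_n.+1) : phase R n :=
  (0, delta_mx 0 a, 0).
Definition unit_cq (R : realType) (n : nat) (a : 'I_n.+1) : contact R n :=
  (delta_mx 0 a, 0, 0).
Definition unit_gamma (R : realType) (n : nat) (a : 'I_n) : contact R n :=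
  (0, delta_mx 0 a, 0).

(* The curves are parametrised by t itself, so that the equation dt/dt = 1 is
   built in. *)
Definition canonical_solution (R : realType) (n : nat) (H : phase R n -> R)
    (J : set R) (q p : R -> 'rV[R]_n.+1) : Prop :=
  forall t, J t -> forall a : 'I_n.+1,
    is_dot J (fun s => q s 0 a) t ('D_(unit_p R a) H (q t, p t, t)) /\
    is_dot J (fun s => p s 0 a) t (- 'D_(unit_q R a) H (q t, p t, t)).

Definition contact_solution (R : realType) (n : nat) (K : contact R n -> R)
    (J : set R) (q : R -> 'rV[R]_n.+1) (gamma : R -> 'rV[R]_n) : Prop :=
  forall t, J t ->
    let x : contact R n := (q t, gamma t, t) in
    [/\ forall a : 'I_n,
          is_dot J (fun s => q s 0 (lift ord0 a)) t
            ('D_(unit_gamma R a) K x),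
        forall a : 'I_n,
          is_dot J (fun s => gamma s 0 a) t
            (- 'D_(unit_cq R (lift ord0 a)) K x
             - gamma t 0 a * 'D_(unit_cq R ord0) K x)
      & is_dot J (fun s => q s 0 ord0) t
          (- K x + \sum_(b < n) gamma t 0 b * 'D_(unit_gamma R b) K x)].

Definition gamma_of (R : realType) (n : nat) (p : 'rV[R]_n.+1) : 'rV[R]_n :=
  \row_(a < n) (- (p 0 (lift ord0 a) / p 0 ord0)).

Definition to_contact (R : realType) (n : nat) (x : phase R n) : contact R n :=
  (x.1.1, gamma_of x.1.2, x.2).

Definition hamiltonian_of (R : realType) (n : nat) (K : contact R n -> R)
    (x : phase R n) : R :=
  - x.1.2 0 ord0 * K (to_contact x).

(* A differential 1-form: w x v is its value at x on the tangent vector v. *)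
Definition form1 (R : realType) (E : normedModType R) : Type := E -> E -> R.

Definition dform (R : realType) (E : normedModType R) (f : E -> R) : form1 E :=
  fun x v => 'd f x v.

Definition pullback (R : realType) (E F : normedModType R) (f : E -> F)
    (w : form1 F) : form1 E :=
  fun x v => w (f x) ('d f x v).

Definition alpha (R : realType) (n : nat) : form1 (phase R n) :=
  fun x v => \sum_(a < n.+1)
    x.1.2 0 a * dform (fun y : phase R n => y.1.1 0 a) x v.

Definition alphaE (R : realType) (n : nat) (H : phase R n -> R) :
    form1 (phase R n) :=
  fun x v => alpha x v - H x * dform (fun y : phase R n => y.2) x v.

Definition lambda (R : realType) (n : nat) : form1 (contact R n) :=
  fun x v => dform (fun y : contact R n => y.1.1 0 ord0) x v
    - \sum_(a < n)
        x.1.2 0 a * dform (fun y : contact R n => y.1.1 0 (lift ord0 a)) x v.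

Definition lambdaE (R : realType) (n : nat) (K : contact R n -> R) :
    form1 (contact R n) :=
  fun x v => lambda x v + K x * dform (fun y : contact R n => y.2) x v.

(* Main.v *)
Require Import Defs.
From HB Require Import structures.
From mathcomp Require Import all_boot all_order all_algebra.
From mathcomp Require Import all_classical all_reals all_analysis.
From mathcomp Require Import ring.

Import Order.TTheory GRing.Theory Num.Theory.
Import numFieldNormedType.Exports.
Local Open Scope classical_set_scope.
Local Open Scope ring_scope.

(* Since K is only smooth relative to the time interval, it is replaced near a
   point by a smooth g that agrees with it on the time slice; the equations of
   motion only involve derivatives along that slice.  The chain rule for
   g o to_contact gives
     dH/dq^a = - p_0 dK/dq^a,   dH/dp_a = dK/dgamma_a,
     dH/dp_0 = - K + sum_b gamma_b dK/dgamma_b,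
   so q^a and q^0 already satisfy the contact equations, and the equation of
   gamma_a is the quotient rule for - p_a / p_0. *)

(** * Differentials of projections, coordinates and finite sums *)

Lemma is_diff_linear {R : realType} {V W : normedModType R}
    (f : {linear V -> W}) (x : V) : continuous f -> is_diff x f f.
Proof.
by move=> fc; apply: DiffDef; [exact: linear_differentiable | exact: diff_lin].
Qed.

Lemma is_diff_fst {R : realType} {V W : normedModType R} (x : V * W) :
  is_diff x fst fst.
Proof. by apply: is_diff_linear => y; exact: cvg_fst. Qed.

Lemma is_diff_snd {R : realType} {V W : normedModType R} (x : V * W) :
  is_diff x snd snd.
Proof. by apply: is_diff_linear => y; exact: cvg_snd. Qed.

Lemma is_diff_coord {R : realType} {m n : nat} (i : 'I_m) (j : 'I_n)
    (M : 'M[R]_(m, n)) :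
  is_diff M (fun N : 'M[R]_(m, n) => N i j) (fun N : 'M[R]_(m, n) => N i j).
Proof.
have lin : linear (fun N : 'M[R]_(m, n) => N i j) by move=> k A B; rewrite !mxE.
pose fM := GRing.isLinear.Build _ _ _ _ _ lin.
pose f : {linear _ -> _} := HB.pack (fun N : 'M[R]_(m, n) => N i j) fM.
exact: (@is_diff_linear _ _ _ f M (@coord_continuous _ _ _ i j)).
Qed.

Lemma is_diff_sum {R : realType} {V W : normedModType R} {n : nat}
    (f df : 'I_n -> V -> W) (x : V) :
  (forall i, is_diff x (f i) (df i)) ->
  is_diff x (\sum_(i < n) f i) (\sum_(i < n) df i).
Proof.
move=> dfx; apply: (big_ind2 (fun g dg : V -> W => is_diff x g dg)) => //.
- exact: is_diff_cst.
- by move=> *; exact: is_diffD.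
Qed.

(** * Differentials of the passage to contact coordinates and of the Hamiltonian *)

(** Quotient rule for - p_a / p_0, with [v] in the role of dp. *)
Definition dgamma {R : realType} {n : nat} (p v : 'rV[R]_n.+1) : 'rV[R]_n :=
  \row_(a < n) (p 0 (lift ord0 a) * v 0 ord0 / p 0 ord0 ^+ 2
                - v 0 (lift ord0 a) / p 0 ord0).

Lemma is_diff_gamma_of {R : realType} {n : nat} (p : 'rV[R]_n.+1) :
  p 0 ord0 != 0 -> is_diff p (@gamma_of R n) (dgamma p).
Proof.
move=> p0.
pose P a : 'rV[R]_n.+1 -> R := fun q => q 0 a.
have dP a : is_diff p (P a) (P a) by exact: is_diff_coord.
have dV : is_diff p (GRing.inv \o P ord0)
    (( *:%R (- p 0 ord0 ^- 2)) \o P ord0).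
  apply: is_diff_comp.
  by apply: DiffDef; [exact: differentiable_Rinv | exact: diff_Rinv].
have dg a := is_diffN (is_diffM (dP (lift ord0 a)) dV).
(* Each scalar component is multiplied by its basis row; the sum of these rows is [gamma_of]. *)
have dga a := is_diff_comp (dg a) (is_diff_scalel _ (delta_mx 0 a : 'rV[R]_n)).
have := is_diff_sum _ _ _ dga.
set F := \sum_i _; set dF := \sum_i _.
have -> : F = @gamma_of R n.
  apply/funext => q; rewrite [RHS]row_sum_delta /F fct_sumE.
  by apply: eq_bigr => a _; rewrite mxE.
suff -> : dF = dgamma p by [].
apply/funext => v; rewrite [RHS]row_sum_delta /dF fct_sumE.
apply: eq_bigr => a _; rewrite mxE /= /P /=; congr (_ *: _).
rewrite !fctE /= /GRing.scale /=; by field.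
Qed.

Definition dcontact {R : realType} {n : nat} (x v : phase R n) : contact R n :=
  (v.1.1, dgamma x.1.2 v.1.2, v.2).

Lemma is_diff_to_contact {R : realType} {n : nat} (x : phase R n) :
  x.1.2 0 ord0 != 0 -> is_diff x (@to_contact R n) (dcontact x).
Proof.
move=> p0.
have d1 := is_diff_fst x; have d2 := is_diff_snd x.
have d11 := is_diff_comp d1 (is_diff_fst x.1).
have d12 := is_diff_comp d1 (is_diff_snd x.1).
have dg := is_diff_comp d12 (is_diff_gamma_of _ p0).
exact: is_diff_pair (is_diff_pair d11 dg) d2.
Qed.

Lemma is_diff_hamiltonian_of {R : realType} {n : nat} (g : contact R n -> R)
    (x : phase R n) :
  x.1.2 0 ord0 != 0 -> differentiable g (to_contact x) ->
  is_diff x (hamiltonian_of g)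
    (fun v => - v.1.2 0 ord0 * g (to_contact x)
              - x.1.2 0 ord0 * 'd g (to_contact x) (dcontact x v)).
Proof.
move=> p0 dg.
have d1 := is_diff_fst x.
have d12 := is_diff_comp d1 (is_diff_snd x.1).
have dp := is_diffN (is_diff_comp d12 (is_diff_coord 0 ord0 _)).
have dgc := is_diff_comp (is_diff_to_contact _ p0) (differentiableP dg).
have H := is_diffM dp dgc; apply: (@is_diff_eq _ _ _ _ _ _ _ H).
apply/funext => v; rewrite !fctE /= /GRing.scale /=; ring.
Qed.

(** * Derivatives along a time slice *)

(** As [v] has no time component, the line through [x] along [v] stays at time [x.2], where [f] and
    [g] agree near [x]. *)
Lemma near_slice_derive {R : realType} {E : normedModType R} {I : set R}
    {f g : E * R -> R} {x v : E * R} :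
  I x.2 -> v.2 = 0 -> (\forall y \near x, I y.2 -> f y = g y) ->
  'D_v f x = 'D_v g x.
Proof.
move=> Ix v0 fg; have fgx : f x = g x by exact: nbhs_singleton fg Ix.
have line : h *: v + x @[h --> (0 : R)] --> x.
  rewrite -[X in _ --> X](_ : 0 *: v + x = x); last by rewrite scale0r add0r.
  by apply: cvgD; [exact: (@scalel_continuous _ _ v 0) | exact: cvg_cst].
have fgl : \forall h \near (0 : R), f (h *: v + x) = g (h *: v + x).
  apply: (@filterS _ (nbhs (0 : R)) _ _ _ _ (line _ fg)) => h /= fgh.
  by apply: fgh; rewrite v0 scaler0 add0r.
(* Both derivatives are limits of one and the same image filter, so the equality does not depend on
   convergence. *)
rewrite /derive fgx; congr (lim _); rewrite eqEsubset.
by split; apply/near_eq_cvg/cvg_within; apply: filterS fgl => h /= ->.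
Qed.

Lemma smooth_on_slice {R : realType} {E : normedModType R} {I : set R}
    {K : E * R -> R} {x : E * R} :
  smooth_on [set y : E * R | I y.2] K -> I x.2 ->
  exists2 g : E * R -> R,
    differentiable g x & \forall y \near x, I y.2 -> K y = g y.
Proof.
move=> hK Ix; have [U [g [oU Ux smooth_g Kg]]] := hK x Ix.
exists g; first by have [dg _] := smooth_g 1%N; exact: dg.
apply: (@filterS _ (nbhs x) _ _ _ _ (open_nbhs_nbhs (conj oU Ux))) => y Uy Iy.
exact: Kg.
Qed.

(** Gives [linearZ] with the product of [R] in place of [*:], ready for ring rewriting. *)
Lemma linear_realZ {R : realType} {V : lmodType R} (l : {linear V -> R})
    (k : R) (w : V) : l (k *: w) = k * l w.
Proof. exact: linearZ. Qed.

(* l is the differential of a local smooth extension of K. *)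
Lemma derive_hamiltonian_of {R : realType} {n : nat} {I : set R}
    {K : contact R n -> R} {x : phase R n}
    (hK : smooth_on [set y : contact R n | I y.2] K)
    (Ix : I x.2) (p0 : x.1.2 0 ord0 != 0) :
  exists l : {linear contact R n -> R},
  (forall v : contact R n, v.2 = 0 -> 'D_v K (to_contact x) = l v) /\
  (forall v : phase R n, v.2 = 0 -> 'D_v (hamiltonian_of K) x =
     - v.1.2 0 ord0 * K (to_contact x) - x.1.2 0 ord0 * l (dcontact x v)).
Proof.
have [g dg Kg] := smooth_on_slice hK (Ix : I (to_contact x).2).
exists ('d g (to_contact x)); split=> v v0.
  by rewrite (near_slice_derive _ _ Kg) // deriveE.
have HKg : \forall y \near x,
    I y.2 -> hamiltonian_of K y = hamiltonian_of g y.
  have dtc := is_diff_to_contact x p0.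
  have /differentiable_continuous tc : differentiable (@to_contact R n) x by [].
  (* Agreement of [K] and [g] near [to_contact x] is pulled back along the continuous map
     [to_contact], which preserves time. *)
  apply: (@filterS _ (nbhs x) _ _ _ _ (tc _ Kg)) => y e Iy.
  by rewrite /hamiltonian_of e.
have dH := is_diff_hamiltonian_of g x p0 dg.
rewrite (near_slice_derive _ _ HKg) //.
by rewrite deriveE // diff_val (nbhs_singleton Kg Ix).
Qed.

(** * Partial derivatives of the Hamiltonian *)

Lemma derive_hamiltonian_q {R : realType} {n : nat} {I : set R}
    {K : contact R n -> R} {x : phase R n}
    (hK : smooth_on [set y : contact R n | I y.2] K)
    (Ix : I x.2) (p0 : x.1.2 0 ord0 != 0) (a : 'I_n.+1) :
  'D_(unit_q R a) (hamiltonian_of K) x =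
  - x.1.2 0 ord0 * 'D_(unit_cq R a) K (to_contact x).
Proof.
have [l [lK lH]] := derive_hamiltonian_of hK Ix p0.
rewrite lH // lK //= !mxE oppr0 mul0r sub0r mulNr; congr (- (_ * l _)).
congr (_, _, _); apply/rowP => b; rewrite !mxE; ring.
Qed.

(** Moving p_a alone moves gamma_a at rate - 1 / p_0, which cancels the factor - p_0 of the
    Hamiltonian. *)
Lemma derive_hamiltonian_p {R : realType} {n : nat} {I : set R}
    {K : contact R n -> R} {x : phase R n}
    (hK : smooth_on [set y : contact R n | I y.2] K)
    (Ix : I x.2) (p0 : x.1.2 0 ord0 != 0) (a : 'I_n) :
  'D_(unit_p R (lift ord0 a)) (hamiltonian_of K) x =
  'D_(unit_gamma R a) K (to_contact x).
Proof.
have [l [lK lH]] := derive_hamiltonian_of hK Ix p0.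
rewrite lH // lK //= !mxE /= mulr0n oppr0 mul0r sub0r.
have -> : dcontact x (unit_p R (lift ord0 a)) =
    (- (x.1.2 0 ord0)^-1) *: unit_gamma R a.
  apply/pair_equal_spec; split; last by rewrite /= scaler0.
  apply/pair_equal_spec; split; first by rewrite /= scaler0.
  apply/rowP => b; rewrite !mxE /= mulr0n (inj_eq lift_inj); ring.
by rewrite (linear_realZ l) mulNr mulrN opprK mulVKf.
Qed.

(** Moving p_0 alone moves all of gamma at rate - gamma / p_0; the explicit factor - p_0 contributes
    the term - K. *)
Lemma derive_hamiltonian_p0 {R : realType} {n : nat} {I : set R}
    {K : contact R n -> R} {x : phase R n}
    (hK : smooth_on [set y : contact R n | I y.2] K)
    (Ix : I x.2) (p0 : x.1.2 0 ord0 != 0) :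
  'D_(unit_p R ord0) (hamiltonian_of K) x =
  - K (to_contact x) + \sum_(b < n)
     (to_contact x).1.2 0 b * 'D_(unit_gamma R b) K (to_contact x).
Proof.
have [l [lK lH]] := derive_hamiltonian_of hK Ix p0.
rewrite lH //= !mxE eqxx mulr1n mulN1r; congr (_ + _).
have -> : dcontact x (unit_p R ord0) =
    (- (x.1.2 0 ord0)^-1) *:
    \sum_(b < n) (to_contact x).1.2 0 b *: unit_gamma R b.
  (* Expanding the gamma direction in the basis lets the linear [l] be evaluated term by term. *)
  have E : (0, gamma_of x.1.2, 0) =
      \sum_(b < n) (to_contact x).1.2 0 b *: unit_gamma R b :> contact R n.
    rewrite {1}[gamma_of _]row_sum_delta.
    elim/big_rec2: _ => // b z y _ <-.
    rewrite -[RHS]/(_ *: 0 + 0, _ *: delta_mx 0 b + y, _ *: 0 + 0).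
    by rewrite !scaler0 !addr0.
  rewrite -E; apply/pair_equal_spec; split; last by rewrite /= scaler0.
  apply/pair_equal_spec; split; first by rewrite /= scaler0.
  by apply/rowP => b; rewrite !mxE /= mulr1n mulr0n; field.
rewrite (linear_realZ l) mulNr mulrN opprK mulVKf // linear_sum.
by apply: eq_bigr => b _; rewrite (linear_realZ l) lK.
Qed.

(** * The quotient rule for derivatives relative to a set *)

Lemma is_dot_div {R : realType} {J : set R} {f g : R -> R} {t df dg : R} :
  (forall s, J s -> g s != 0) -> J t -> is_dot J f t df -> is_dot J g t dg ->
  is_dot J (fun s => f s / g s) t ((df * g t - f t * dg) / g t ^+ 2).
Proof.
move=> g0 Jt hf hg; have gt0 := g0 t Jt.
have st : s - t @[s --> within J t^'] --> 0.
  rewrite -(subrr t); apply: cvgB; last exact: cvg_cst.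
  by move=> A /nbhs_dnbhs; exact: cvg_within.
have J' : \forall s \near within J t^', J s by exact: near_withinT.
have st' : \forall s \near within J t^', s - t != 0.
  apply: cvg_within; apply: (@filterS _ t^' _ _ _ _ (nbhs_dnbhs_neq t)) => s.
  by rewrite subr_eq0.
(* Continuity of [g] at [t] relative to [J], from g(s) = (s - t) times the difference quotient, plus
   g(t). *)
have gc : g s @[s --> within J t^'] --> g t.
  have h : (s - t) * ((s - t)^-1 * (g s - g t)) + g t @[s --> within J t^']
      --> 0 * dg + g t.
    by apply: cvgD; [exact: cvgM | exact: cvg_cst].
  rewrite mul0r add0r in h; apply: cvg_trans h; apply: near_eq_cvg.
  apply: (@filterS _ (within J t^') _ _ _ _ st') => s s0.
  by rewrite mulVKf ?subrK.
(* The difference quotient of f / g, rearranged to show those of [f] and [g]; the two forms agree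
   for [s] in [J] with s != t. *)
pose D s := ((s - t)^-1 * (f s - f t) * g t - f t * ((s - t)^-1 * (g s - g t)))
            / (g s * g t).
have h : D s @[s --> within J t^'] --> (df * g t - f t * dg) / (g t * g t).
  apply: cvgM.
    by apply: cvgB; apply: cvgM => //; exact: cvg_cst.
  by apply: cvgV; [rewrite mulf_neq0 | apply: cvgM => //; exact: cvg_cst].
rewrite -expr2 in h; apply: cvg_trans h; apply: near_eq_cvg.
apply: (@filterS2 _ (within J t^') _ _ _ _ _ J' st') => s Js s0.
by have gs0 := g0 s Js; rewrite /D; field; rewrite gt0 gs0 s0.
Qed.

(** * The identity of one-forms *)

(** General [V] and [W] cover both [phase] and [contact]. *)
Lemma is_diff_q {R : realType} {m : nat} {V W : normedModType R} (a : 'I_m)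
    (x : 'rV[R]_m * V * W) :
  is_diff x (fun y : 'rV[R]_m * V * W => y.1.1 0 a)
    (fun y : 'rV[R]_m * V * W => y.1.1 0 a).
Proof.
exact: is_diff_comp (is_diff_comp (is_diff_fst x) (is_diff_fst x.1))
  (is_diff_coord 0 a _).
Qed.

Lemma dform_q {R : realType} {m : nat} {V W : normedModType R} (a : 'I_m)
    (x v : 'rV[R]_m * V * W) :
  dform (fun y : 'rV[R]_m * V * W => y.1.1 0 a) x v = v.1.1 0 a.
Proof. by rewrite /dform; have d := is_diff_q a x; rewrite diff_val. Qed.

Lemma dform_t {R : realType} {V : normedModType R} (x v : V * R) :
  dform (fun y : V * R => y.2) x v = v.2.
Proof. by rewrite /dform; have d := is_diff_snd x; rewrite diff_val. Qed.

(** The form [lambdaE] involves only dq and dt, whose components [to_contact] preserves; what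
    remains is p_a = - p_0 gamma_a and - H = p_0 K. *)
Lemma alphaE_pullback {R : realType} {n : nat} (K : contact R n -> R)
    (x v : phase R n) : x.1.2 0 ord0 != 0 ->
  alphaE (hamiltonian_of K) x v =
  x.1.2 0 ord0 * pullback (@to_contact R n) (lambdaE K) x v.
Proof.
move=> p0; have d := is_diff_to_contact x p0.
have phase_q a : dform (fun y : phase R n => y.1.1 0 a) x v = v.1.1 0 a.
  exact: dform_q.
have contact_q a (w z : contact R n) :
  dform (fun y : contact R n => y.1.1 0 a) w z = z.1.1 0 a by exact: dform_q.
have phase_t : dform (fun y : phase R n => y.2) x v = v.2 by exact: dform_t.
have contact_t (w z : contact R n) :
  dform (fun y : contact R n => y.2) w z = z.2 by exact: dform_t.
rewrite /pullback diff_val /alphaE /lambdaE /alpha /lambda phase_t contact_t.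
rewrite big_ord_recl phase_q contact_q /= /hamiltonian_of.
under eq_bigr do rewrite phase_q.
under [in RHS]eq_bigr do rewrite contact_q /= mxE.
rewrite mulrDr mulrBr mulr_sumr !mulNr opprK mulrA; congr (_ + _ + _).
by rewrite -sumrN; apply: eq_bigr => a _; field.
Qed.

(** * From canonical to contact equations of motion *)

Theorem proposition2p1 (R : realType) (n : nat) (hn : (0 < n)%N)
    (I : set R) (hI : time_interval I)
    (K : contact R n -> R) (hK : smooth_on [set x : contact R n | I x.2] K) :
  (forall (J : set R) (q p : R -> 'rV[R]_n.+1),
      time_interval J -> J `<=` I ->
      (forall t, J t -> p t 0 ord0 != 0) ->
      canonical_solution (hamiltonian_of K) J q p ->
      contact_solution K J q (fun t => gamma_of (p t))) /\
  (forall x : phase R n, I x.2 -> x.1.2 0 ord0 != 0 ->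
     forall v : phase R n,
       alphaE (hamiltonian_of K) x v =
       x.1.2 0 ord0 * pullback (@to_contact R n) (lambdaE K) x v).
Proof.
split=> [J q p _ JI p0 sol t Jt x|x _ p0 v]; last exact: alphaE_pullback.
pose y : phase R n := (q t, p t, t).
have Iy : I y.2 by exact: JI.
have y0 : y.1.2 0 ord0 != 0 by exact: p0.
split=> [a|a|].
- by rewrite -(derive_hamiltonian_p hK Iy y0); have [] := sol t Jt (lift ord0 a).
- have [_ da] := sol t Jt (lift ord0 a); have [_ d0] := sol t Jt ord0.
  have quot := is_dot_div p0 Jt da d0.
  rewrite !(derive_hamiltonian_q hK Iy y0) /= in quot.
  rewrite -[x]/(to_contact y).
  set ka := 'D_(unit_cq R (lift ord0 a)) K (to_contact y) in quot *.
  set k0 := 'D_(unit_cq R ord0) K (to_contact y) in quot *.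
  rewrite /is_dot.
  (* The sign in gamma_a = - p_a / p_0 is pulled out of the difference quotient, so that [quot]
     applies. *)
  have -> : (fun s => (s - t)^-1 * (gamma_of (p s) 0 a - gamma_of (p t) 0 a)) =
     (fun s => - ((s - t)^-1 * (p s 0 (lift ord0 a) / p s 0 ord0
        - p t 0 (lift ord0 a) / p t 0 ord0))).
    by apply/funext => s; rewrite !mxE; ring.
  (* Here the canonical equations read dp_a/dt = p_0 [ka] and dp_0/dt = p_0 [k0]. *)
  have -> : - ka - gamma_of (p t) 0 a * k0 =
      - ((- (- p t 0 ord0 * ka) * p t 0 ord0
          - p t 0 (lift ord0 a) * - (- p t 0 ord0 * k0)) / p t 0 ord0 ^+ 2).
    by rewrite mxE; field; exact: p0.
  exact: cvgN quot.
- by rewrite -(derive_hamiltonian_p0 hK Iy y0); have [] := sol t Jt ord0.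
Qed.
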